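(* Let $\mathbb{K}$ be a field, $r\in\mathbb{K}$ invertible and $q:=r-1$. For each partition diagram $\pi$ let $$\kappa^{(q)}_\pi:=\sum_{\sigma\le\pi}(-1)^{l(\sigma)-l(\pi)}r^{-l(\sigma)}H_\sigma,\qquad R_\pi:=\sum_{\sigma\ge\pi}(-1)^{l(\sigma)-l(\pi)}H_\sigma$$ in $\mathrm{ParSym}$. Then: (1) for any partition diagram $\pi$, $$R_\pi=r\sum_{\rho:\ \rho\sim\pi}(-1)^{|S(\rho)\setminus S(\pi)|+l(\rho)-l(\pi)}q^{|S(\rho)\cap S(\pi)|}\kappa^{(q)}_\rho;$$ (2) for any $\pi\in I_n$, $$\kappa^{(q)}_\pi=r^{-n}\sum_{\rho:\ \rho\sim\pi}(-1)^{|S(\pi)\setminus S(\rho)|+l(\rho)-l(\pi)}q^{|[n-1]\setminus(S(\rho)\cup S(\pi))|}R_\rho.$$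
   Context: Conventions: $q^0=1$ (also if $q=0$); $[m]=\{1,\dots,m\}$, which is empty for $m\le0$. **Partition diagrams.** A partition diagram of order $k\ge 0$ is a set partition of $\{1,\dots,k,1',\dots,k'\}$; for $k=0$ the only one is the empty diagram $\emptyset$. For $\pi$ of order $k$ and $\rho$ of order $m$, $\pi\otimes\rho$ is the diagram of order $k+m$ whose blocks are the blocks of $\pi$ and the blocks of $\rho$ with labels shifted by $k$ ($i\mapsto i+k$, $i'\mapsto (i+k)'$). If $k,m\ge1$, $\pi\bullet\rho$ is obtained from $\pi\otimes\rho$ by merging the block containing $k'$ with the block containing $(k+1)'$. The empty diagram is the unit for both operations. A diagram is $\otimes$-irreducible (resp. $\bullet$-irreducible) if it is not $\rho\otimes\sigma$ (resp. $\rho\bullet\sigma$) with $\rho,\sigma$ both non-empty. Every non-empty $\pi$ is uniquely $\pi_1\otimes\cdots\otimes\pi_l$ with all $\pi_i$ non-empty and $\otimes$-irreducible; $l(\pi):=l$, and $l(\emptyset):=0$. **Refinement.** Every non-empty $\pi$ can be uniquely written $\pi=\pi_1\divideontimes_1\pi_2\divideontimes_2\cdots\divideontimes_{n-1}\pi_n$ with each $\divideontimes_i\in\{\otimes,\bullet\}$ and each $\pi_i$ non-empty and both $\otimes$- and $\bullet$-irreducible (on non-empty diagrams $\otimes$ and $\bullet$ associate with each other). $I_n$ ($n\ge1$) is the set of diagrams with exactly $n$ such factors, and $I_0=\{\emptyset\}$. Put $S(\pi)=\{i\in[n-1]:\divideontimes_i=\otimes\}$, and $S(\emptyset)=\varnothing$.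 For non-empty $\pi,\sigma$ write $\pi\sim\sigma$ if their sequences $(\pi_1,\dots,\pi_n)$ and $(\sigma_1,\dots,\sigma_m)$ are equal; $\pi\le\sigma$ if $\pi\sim\sigma$ and $S(\sigma)\subseteq S(\pi)$. The empty diagram is related only to itself, with $\emptyset\sim\emptyset$ and $\emptyset\le\emptyset$. **ParSym** is the $\mathbb{K}$-vector space with basis $\{H_\pi\}$ indexed by all partition diagrams.
   Formalization: Part (1) is stated only for non-empty π: for π=∅ one has R_∅ = κ_∅ = H_∅ while the right-hand side is r·H_∅, so the identity fails there unless r=1. *)

(* Defs.v *)
From HB Require Import structures.
From mathcomp Require Import all_boot all_order all_algebra finmap.
From mathcomp.classical Require classical_sets.
From mathcomp.multinomials Require Import monalg.

Set Implicit Arguments.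
Unset Strict Implicit.
Unset Printing Implicit Defensive.

Import GRing.Theory.
Local Open Scope ring_scope.

(* inl i is the label i+1, and inr i is the label (i+1)'. *)
Definition vertex (k : nat) : Type := ('I_k + 'I_k)%type.
HB.instance Definition _ k := Finite.on (vertex k).

Record diagram (k : nat) := Diagram {
  blocks :> {set {set vertex k}};
  blocks_partition : partition blocks [set: vertex k]
}.
HB.instance Definition _ k := [isSub for @blocks k].
HB.instance Definition _ k := [Finite of diagram k by <:].

(* Partition diagrams of all orders. *)
Definition pdiagram : Type := {k : nat & diagram k}.
HB.instance Definition _ := Choice.on pdiagram.

Definition dorder (pi : pdiagram) : nat := tag pi.

Definition pdiagram_of k (pi : diagram k) : pdiagram := Tagged diagram pi.
Coercion pdiagram_of : diagram >-> pdiagram.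

Definition left_vertex k m (v : vertex k) : vertex (k + m) :=
  match v with inl i => inl (lshift m i) | inr i => inr (lshift m i) end.

Definition right_vertex k m (v : vertex m) : vertex (k + m) :=
  match v with inl i => inl (rshift k i) | inr i => inr (rshift k i) end.

Arguments left_vertex {k} m v.
Arguments right_vertex k {m} v.

Lemma left_vertex_inj k m : injective (@left_vertex k m).
Proof. by case=> i [] j //= [] /val_inj ->. Qed.

Lemma right_vertex_inj k m : injective (@right_vertex k m).
Proof. by case=> i [] j //= [] /addnI /val_inj ->. Qed.

Lemma left_right_vertex k m (u : vertex k) (v : vertex m) :
  left_vertex m u != right_vertex k v.
Proof.
by case: u v => i [] j //=; apply/eqP=> -[] eij; have := ltn_ord i;
  rewrite eij ltnNge leq_addr.
Qed.

Lemma left_right_vertexP k m (v : vertex (k + m)) :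
  (exists u, v = left_vertex m u) \/ (exists u, v = right_vertex k u).
Proof.
by case: v => i; case: (split_ordP i) => j ->;
  [left; exists (inl j) | right; exists (inl j)
  | left; exists (inr j) | right; exists (inr j)].
Qed.

Definition tensor_blocks k m (pi : diagram k) (rho : diagram m) :
    {set {set vertex (k + m)}} :=
  [set left_vertex m @: B | B : {set vertex k} in blocks pi]
    :|: [set right_vertex k @: B | B : {set vertex m} in blocks rho].

Lemma tensor_partition k m (pi : diagram k) (rho : diagram m) :
  partition (tensor_blocks pi rho) [set: vertex (k + m)].
Proof.
have /and3P[/eqP cpi /trivIsetP tpi npi] := blocks_partition pi.
have /and3P[/eqP crho /trivIsetP trho nrho] := blocks_partition rho.
have dis (A : {set vertex k}) (B : {set vertex m}) :
    [disjoint left_vertex m @: A & right_vertex k @: B].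
  rewrite -setI_eq0; apply/eqP/setP=> v; rewrite !inE; apply/negP.
  case/andP=> /imsetP[u _ ->] /imsetP[w _ /eqP].
  by rewrite (negPf (left_right_vertex u w)).
apply/and3P; split.
- rewrite eqEsubset subsetT /=; apply/subsetP=> v _.
  have [[u ->]|[u ->]] := left_right_vertexP v.
    have : u \in cover (blocks pi) by rewrite cpi inE.
    case/bigcupP=> B Bpi uB; apply/bigcupP; exists (left_vertex m @: B).
      by rewrite inE imset_f.
    by rewrite imset_f.
  have : u \in cover (blocks rho) by rewrite crho inE.
  case/bigcupP=> B Brho uB; apply/bigcupP; exists (right_vertex k @: B).
    by rewrite inE (imset_f _ Brho) orbT.
  by rewrite imset_f.
- apply/trivIsetP=> A B.
  rewrite !inE => /orP[] /imsetP[A' hA ->] /orP[] /imsetP[B' hB ->] neq //.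
  + rewrite imset_disjoint; last exact: left_vertex_inj.
    by apply: tpi => //; apply: contraNneq neq => ->.
  + by rewrite disjoint_sym.
  + rewrite imset_disjoint; last exact: right_vertex_inj.
    by apply: trho => //; apply: contraNneq neq => ->.
- rewrite inE; apply/norP; split; apply/imsetP=> -[B hB /esym/eqP];
    rewrite imset_eq0 => /eqP B0; [move: npi | move: nrho]; by rewrite -B0 hB.
Qed.

Definition merge_blocks (T : finType) (P : {set {set T}}) (a b : T) :
    {set {set T}} :=
  (pblock P a :|: pblock P b) |: (P :\: [set pblock P a; pblock P b]).

Lemma merge_partition (T : finType) (P : {set {set T}}) (a b : T) :
  partition P [set: T] -> partition (merge_blocks P a b) [set: T].
Proof.
move=> partP; have /and3P[/eqP cP tP nP] := partP.
have inP x : pblock P x \in P by rewrite pblock_mem // cP inE.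
have tP' := trivIsetP tP.
have dis C : C \in P :\: [set pblock P a; pblock P b] ->
    [disjoint pblock P a :|: pblock P b & C].
  rewrite !inE negb_or => /andP[/andP[na nb] hC].
  rewrite -setI_eq0 setIUl setU_eq0 !setI_eq0.
  by rewrite !tP' // eq_sym.
apply/and3P; split.
- rewrite eqEsubset subsetT /=; apply/subsetP=> x _.
  have xx : x \in pblock P x by rewrite mem_pblock cP inE.
  apply/bigcupP.
  case: (boolP (pblock P x \in [set pblock P a; pblock P b])) => hx.
    exists (pblock P a :|: pblock P b); first by rewrite !inE eqxx.
    by move: hx; rewrite !inE => /orP[] /eqP <-; rewrite xx ?orbT.
  by exists (pblock P x) => //; rewrite inE in_setD hx inP orbT.
- apply/trivIsetP=> A B.
  case/setU1P=> [->|hA] /setU1P[->|hB] neq.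
  + by rewrite eqxx in neq.
  + exact: dis.
  + by rewrite disjoint_sym dis.
  + by move: hA hB => /setDP[hA _] /setDP[hB _]; apply: tP'.
- rewrite in_setU1 in_setD (negPf nP) andbF orbF eq_sym setU_eq0.
  apply/negP=> /andP[/eqP a0 _]; move: (inP a); by rewrite a0 (negPf nP).
Qed.

Definition diagram_tensor k m (pi : diagram k) (rho : diagram m) :
  diagram (k + m) := Diagram (tensor_partition pi rho).

(* The merged vertices are k' and (k+1)', for pi of order k >= 1. *)
Definition diagram_bullet k m (pi : diagram k.+1) (rho : diagram m.+1) :
    diagram (k.+1 + m.+1) :=
  Diagram (merge_partition (inr (lshift m.+1 ord_max)) (inr (rshift k.+1 ord0))
    (tensor_partition pi rho)).

Lemma empty_partition : partition set0 [set: vertex 0].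
Proof.
apply/and3P; split; last by rewrite inE.
- by rewrite /cover big_set0; apply/eqP/setP=> -[] [].
- by apply/trivIsetP=> A B; rewrite inE.
Qed.

Definition empty_diagram : pdiagram := Diagram empty_partition.

Definition tensor (pi rho : pdiagram) : pdiagram :=
  diagram_tensor (tagged pi) (tagged rho).

Definition bullet (pi rho : pdiagram) : pdiagram :=
  match pi, rho with
  | existT 0 _, _ => rho
  | _, existT 0 _ => pi
  | existT k.+1 pi', existT m.+1 rho' => diagram_bullet pi' rho'
  end.

Definition irreducible (op : pdiagram -> pdiagram -> pdiagram)
    (pi : pdiagram) : Prop :=
  ~ exists rho sigma, [/\ rho != empty_diagram, sigma != empty_diagram
                        & pi = op rho sigma].

(* For pi empty, the factorization is the empty sequence. *)
Definition tensor_factorization (pi : pdiagram) (s : seq pdiagram) : Prop :=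
  [/\ forall p, p \in s -> p != empty_diagram /\ irreducible tensor p
    & pi = \big[tensor/empty_diagram]_(p <- s) p].

(* The factorization is unique, so the choice made by xget does not matter; the
   same holds for refinement below. *)
Definition tensor_factors (pi : pdiagram) : seq pdiagram :=
  classical_sets.xget [::] (tensor_factorization pi).

Definition ell (pi : pdiagram) : nat := size (tensor_factors pi).

(* pi_1 op_1 pi_2 ... op_(n-1) pi_n, where an operation is encoded by a boolean:
   true for tensor, false for bullet. *)
Definition refined_product (s : seq pdiagram) (ops : seq bool) : pdiagram :=
  if s is p :: s' then
    foldl (fun acc x => (if x.1 then tensor else bullet) acc x.2) p (zip ops s')
  else empty_diagram.

(* The empty diagram has the only refinement ([::], [::]): it is the element of
   Iset 0, its Sset is empty, and it is related only to itself. *)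
Definition refinement_of (pi : pdiagram) (x : seq pdiagram * seq bool) : Prop :=
  [/\ forall p, p \in x.1 ->
        [/\ p != empty_diagram, irreducible tensor p & irreducible bullet p],
      size x.2 = (size x.1).-1
    & pi = refined_product x.1 x.2].

Definition refinement (pi : pdiagram) : seq pdiagram * seq bool :=
  classical_sets.xget ([::], [::]) (refinement_of pi).

Definition factors (pi : pdiagram) : seq pdiagram := (refinement pi).1.
Definition operations (pi : pdiagram) : seq bool := (refinement pi).2.

Definition Iset (n : nat) : pred pdiagram := [pred pi | size (factors pi) == n].

(* [m] = {1, ..., m} *)
Definition upto (m : nat) : {fset nat} := [fset i in iota 1 m]%fset.

(* The operations are numbered from 1 in Sset, and from 0 in the list. *)
Definition Sset (pi : pdiagram) : {fset nat} :=
  [fset i in upto (size (factors pi)).-1 | nth false (operations pi) i.-1]%fset.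

Definition sim (pi sigma : pdiagram) : bool := factors pi == factors sigma.

Definition ple (pi sigma : pdiagram) : bool :=
  sim pi sigma && (Sset sigma `<=` Sset pi)%fset.

Definition ParSym (K : fieldType) : lmodType K := {malg K[pdiagram]}.

Definition Hbasis (K : fieldType) (pi : pdiagram) : ParSym K := << pi >>.

(* Related diagrams have the same order, namely the sum of the orders of their
   common factors, so the sums over all sigma related to pi are (finite) sums
   over the diagrams of the order of pi. *)

(* kappa r is the family kappa^(q) for q = r - 1. *)
Definition kappa (K : fieldType) (r : K) (pi : pdiagram) : ParSym K :=
  \sum_(sigma : diagram (dorder pi) | ple sigma pi)
    ((-1) ^ ((ell sigma)%:Z - (ell pi)%:Z) * r ^- ell sigma) *: Hbasis K sigma.

Definition ribbon (K : fieldType) (pi : pdiagram) : ParSym K :=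
  \sum_(sigma : diagram (dorder pi) | ple pi sigma)
    (-1) ^ ((ell sigma)%:Z - (ell pi)%:Z) *: Hbasis K sigma.

(* Main.v *)
(* Fix the sequence of irreducible factors of pi, of length n. By uniqueness of
   refinement, the diagrams similar to pi correspond to the subsets S of [n-1],
   and the order on them is reverse inclusion; moreover l = |S| + 1. After
   exchanging the two sums, the coefficient of each H_sigma is a sum over the
   subsets T of S(sigma), or over its supersets, which factors as a product over
   the elements of [n-1] whose factors are 0, 1 or q + 1 = r.
   Uniqueness of refinement follows from a Levi-type lemma: if two products of
   the same diagram cut it at different places, then the longer right factor is
   itself cut by the other product. *)
From HB Require Import structures.
Require Import Defs.
From mathcomp Require Import all_boot all_order all_algebra finmap.
From mathcomp Require Import zify.
From mathcomp.classical Require classical_sets boolp.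
Import GRing.Theory.

Set Implicit Arguments.
Unset Strict Implicit.
Unset Printing Implicit Defensive.

(** * Diagrams as relations on nodes *)

(* (false, i) is the label i+1 and (true, i) the label (i+1)', with no bound on i:
   nodes are common to the vertices of diagrams of all orders. *)
Definition node : Type := bool * nat.

Definition code k (x : vertex k) : node :=
  match x with inl i => (false, val i) | inr i => (true, val i) end.

Definition shift (k : nat) (u : node) : node := (u.1, k + u.2).

Definition unshift (k : nat) (u : node) : node := (u.1, u.2 - k).

(** The equivalence relation of the set partition, carried over to nodes and false outside the
    vertices of [pi]; it compares diagrams of different orders without casts. *)
Definition linked (pi : pdiagram) (u v : node) : bool :=
  [exists x, exists y,
    [&& code x == u, code y == v & y \in pblock (blocks (tagged pi)) x]].

Lemma code_inj k : injective (@code k).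
Proof. by case=> i [] j //= [] /val_inj ->. Qed.

Lemma code_lt k (x : vertex k) : (code x).2 < k.
Proof. by case: x => i /=. Qed.

Lemma codeP k (u : node) : u.2 < k -> exists x : vertex k, u = code x.
Proof.
case: u => [[] i] /= lt_ik; first by exists (inr (Ordinal lt_ik)).
by exists (inl (Ordinal lt_ik)).
Qed.

Lemma code_left k m (x : vertex k) : code (left_vertex m x) = code x.
Proof. by case: x. Qed.

Lemma code_right k m (x : vertex m) : code (right_vertex k x) = shift k (code x).
Proof. by case: x. Qed.

Lemma shiftK k u : unshift k (shift k u) = u.
Proof. by case: u => b i; rewrite /unshift /shift /= addKn. Qed.

Lemma linked_code k (P : diagram k) (x y : vertex k) :
  linked P (code x) (code y) = (y \in pblock P x).
Proof.
apply/existsP/idP => [[x' /existsP[y' /and3P[/eqP/code_inj-> /eqP/code_inj->]]]//|].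
by move=> xy; exists x; apply/existsP; exists y; rewrite !eqxx.
Qed.

Lemma mem_pblockT k (P : diagram k) (x : vertex k) : x \in pblock P x.
Proof. by rewrite mem_pblock (cover_partition (blocks_partition P)) inE. Qed.

Lemma pblock_memT k (P : diagram k) (x : vertex k) : pblock P x \in blocks P.
Proof. by rewrite pblock_mem // (cover_partition (blocks_partition P)) inE. Qed.

Lemma diagram_trivIset k (P : diagram k) : trivIset (blocks P).
Proof. by have /and3P[] := blocks_partition P. Qed.

Lemma pblock_eqE k (P : diagram k) (x y : vertex k) :
  (pblock P x == pblock P y) = (y \in pblock P x).
Proof.
rewrite eq_pblock ?(diagram_trivIset P) //.
by rewrite (cover_partition (blocks_partition P)) inE.
Qed.

Lemma linked_sym pi u v : linked pi u v = linked pi v u.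
Proof.
suff imp u' v' : linked pi u' v' -> linked pi v' u' by apply/idP/idP; apply: imp.
case: pi => k P /existsP[x /existsP[y /and3P[/eqP<- /eqP<-]]].
by rewrite (linked_code P) -!pblock_eqE eq_sym.
Qed.

Lemma linked_refl pi u : u.2 < dorder pi -> linked pi u u.
Proof.
by case: pi => k P /codeP[x ->]; rewrite (linked_code P) mem_pblockT.
Qed.

(** A set partition is determined by its equivalence relation, so identities between products can be
    checked link by link. *)
Lemma pdiagram_ext pi rho : dorder pi = dorder rho ->
    (forall u v, u.2 < dorder pi -> v.2 < dorder pi ->
      linked pi u v = linked rho u v) ->
  pi = rho.
Proof.
case: pi rho => k P [m Q] /= eqkm; rewrite /dorder /= in eqkm.
case: m / eqkm Q => Q eqPQ; congr (existT _ k _); apply: val_inj => /=.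
have eq_pb x : pblock P x = pblock Q x.
  apply/setP=> y; rewrite -!linked_code.
  by apply: eqPQ; apply: code_lt.
have sub (P' Q' : diagram k) : (forall x, pblock P' x = pblock Q' x) ->
    blocks P' \subset blocks Q'.
  move=> e; apply/subsetP=> B BP.
  have /and3P[_ tP nP] := blocks_partition P'.
  have [B0|[x xB]] := set_0Vmem B; first by rewrite B0 (negPf nP) in BP.
  by rewrite -(def_pblock tP BP xB) e pblock_memT.
by apply/eqP; rewrite eqEsubset !sub.
Qed.

Lemma dorder_eq0 pi : (dorder pi == 0) = (pi == empty_diagram).
Proof.
apply/eqP/eqP => [pi0|-> //]; apply: pdiagram_ext => // u v; by rewrite pi0.
Qed.

Lemma dorder_gt0 pi : (0 < dorder pi) = (pi != empty_diagram).
Proof. by rewrite lt0n dorder_eq0. Qed.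

Lemma pblock_tensor_left k m (P : diagram k) (Q : diagram m) x :
  pblock (diagram_tensor P Q) (left_vertex m x) = left_vertex m @: pblock P x.
Proof.
apply: def_pblock (diagram_trivIset _) _ _; last by rewrite imset_f ?mem_pblockT.
by rewrite /= inE imset_f ?pblock_memT.
Qed.

Lemma pblock_tensor_right k m (P : diagram k) (Q : diagram m) x :
  pblock (diagram_tensor P Q) (right_vertex k x) = right_vertex k @: pblock Q x.
Proof.
apply: def_pblock (diagram_trivIset _) _ _; last by rewrite imset_f ?mem_pblockT.
by rewrite /= inE (imset_f _ (pblock_memT _ _)) orbT.
Qed.

Lemma right_in_left k m (A : {set vertex k}) (x : vertex m) :
  (right_vertex k x \in left_vertex m @: A) = false.
Proof.
apply/imsetP=> -[y _ /esym/eqP]; by rewrite (negPf (left_right_vertex y x)).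
Qed.

Lemma left_in_right k m (A : {set vertex m}) (x : vertex k) :
  (left_vertex m x \in right_vertex k @: A) = false.
Proof.
apply/imsetP=> -[y _ /eqP]; by rewrite (negPf (left_right_vertex x y)).
Qed.

Lemma pblock_merge k (P : diagram k) (a b x : vertex k) :
  pblock (merge_blocks P a b) x =
    if x \in pblock P a :|: pblock P b then pblock P a :|: pblock P b
    else pblock P x.
Proof.
have /and3P[_ tM _] := merge_partition a b (blocks_partition P).
case: ifP => hx; apply: def_pblock tM _ _; rewrite ?mem_pblockT //.
  by rewrite !inE eqxx.
rewrite in_setU1 in_setD pblock_memT andbT !inE negb_or.
move/negbT: hx; rewrite inE negb_or => /andP[xa xb].
by rewrite ![pblock P x == _]eq_sym !pblock_eqE xa xb orbT.
Qed.

(** * The two products *)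

Definition mixed_op (b : bool) : pdiagram -> pdiagram -> pdiagram :=
  if b then tensor else bullet.

Lemma dorder_mixed_op b pi rho : dorder (mixed_op b pi rho) = dorder pi + dorder rho.
Proof.
case: b => //; case: pi rho => [[|k] P] [[|m] Q] //=.
by rewrite /dorder /= addn0.
Qed.

(** Merging involves only the block of the last primed label of [pi], the node [(true, k.-1)], and
    that of the first primed label of [rho]; links across the cut pass through these two. The
    hypothesis excludes [bullet] with an empty argument, where nothing is merged. *)
Lemma linked_mixed_op b pi rho u v (k := dorder pi) :
    b || ((pi != empty_diagram) && (rho != empty_diagram)) ->
    u.2 < k + dorder rho -> v.2 < k + dorder rho ->
  linked (mixed_op b pi rho) u v =
    if u.2 < k then
      if v.2 < k then linked pi u v
      else ~~ b && linked pi u (true, k.-1)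
                && linked rho (unshift k v) (true, 0)
    else
      if v.2 < k then ~~ b && linked pi v (true, k.-1)
                           && linked rho (unshift k u) (true, 0)
      else linked rho (unshift k u) (unshift k v).
Proof.
rewrite {}/k -!dorder_gt0.
case: pi rho => [k P] [m Q]; rewrite /dorder /= => hb.
move=> /codeP[x ->] /codeP[y ->].
have lft (z : vertex k) : ((code (left_vertex m z)).2 < k) by rewrite code_left code_lt.
have rgt (z : vertex m) : ((code (right_vertex k z)).2 < k) = false.
  by rewrite code_right /= ltnNge leq_addr.
have ush (z : vertex m) : unshift k (code (right_vertex k z)) = code z.
  by rewrite code_right shiftK.
case: b hb => [_|/= /andP[k0 m0]].
  rewrite /mixed_op /tensor (linked_code (diagram_tensor P Q)) /=.
  have [[x' ->]|[x' ->]] := left_right_vertexP x;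
  have [[y' ->]|[y' ->]] := left_right_vertexP y;
  rewrite ?lft ?rgt ?ush ?code_left ?linked_code
    ?(pblock_tensor_left P Q) ?(pblock_tensor_right P Q) ?right_in_left
    ?left_in_right //.
  - by rewrite mem_imset //; apply: left_vertex_inj.
  - by rewrite mem_imset //; apply: right_vertex_inj.
case: k P x y k0 lft rgt ush => // k P x y _ lft rgt ush.
case: m Q x y m0 lft rgt ush => // m Q x y _ lft rgt ush.
rewrite (linked_code (diagram_bullet P Q)) (pblock_merge (diagram_tensor P Q)).
rewrite -[inr (lshift _ _)]/(left_vertex m.+1 (inr ord_max)).
rewrite -[inr (rshift _ _)]/(right_vertex k.+1 (inr ord0)).
rewrite (pblock_tensor_left P Q) (pblock_tensor_right P Q).
have -> : (true, k.+1.-1) = code (inr ord_max : vertex k.+1) by [].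
have -> : (true, 0) = code (inr ord0 : vertex m.+1) by [].
have li := @left_vertex_inj k.+1 m.+1; have ri := @right_vertex_inj k.+1 m.+1.
have [[x' ->]|[x' ->]] := left_right_vertexP x;
have [[y' ->]|[y' ->]] := left_right_vertexP y;
rewrite ?lft ?rgt ?ush ?code_left ?linked_code
    ?(pblock_tensor_left P Q) ?(pblock_tensor_right P Q) !in_setU
    ?mem_imset ?right_in_left ?left_in_right ?orbF //=;
  case: ifP => h; rewrite ?in_setU ?mem_imset ?right_in_left ?left_in_right //=
     ?orbF -?pblock_eqE; move: h; rewrite -?pblock_eqE.
all: rewrite ?[_ == pblock P x']eq_sym ?[_ == pblock Q x']eq_sym;
  by [move/eqP-> | move->; rewrite ?andbT ?andbF].
Qed.

Lemma mixed_op_neq0 b pi rho :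
  pi != empty_diagram -> mixed_op b pi rho != empty_diagram.
Proof. by rewrite -!dorder_gt0 dorder_mixed_op addn_gt0 => ->. Qed.

Lemma mixed_op_neq0r b pi rho :
  rho != empty_diagram -> mixed_op b pi rho != empty_diagram.
Proof. by rewrite -!dorder_gt0 dorder_mixed_op addn_gt0 => ->; rewrite orbT. Qed.

(** As [y] is non-empty, the two cuts lie at different places, and the mergings at them can be made
    in either order. *)
Lemma mixed_opA b c x y z :
    x != empty_diagram -> y != empty_diagram -> z != empty_diagram ->
  mixed_op c (mixed_op b x y) z = mixed_op b x (mixed_op c y z).
Proof.
move=> x0 y0 z0; have := (x0, y0, z0); rewrite -!dorder_gt0 => -[[xp yp] zp].
apply: pdiagram_ext => [|u v]; rewrite !dorder_mixed_op ?addnA // => hu hv.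
have un (k m : nat) w : unshift (k + m) w = unshift m (unshift k w).
  by rewrite /unshift /= subnDA.
have xy0 := mixed_op_neq0 b y x0; have yz0 := mixed_op_neq0r c y z0.
rewrite [LHS]linked_mixed_op ?[RHS]linked_mixed_op ?dorder_mixed_op ?x0 ?y0 ?z0 ?xy0
  ?yz0 ?orbT //; try lia.
rewrite !un.
(* Position of a node relative to the two cuts: in [x], in [y] or in [z]. *)
have zone (w : node) : [\/ (w.2 < dorder x) /\ (w.2 < dorder x + dorder y),
    [/\ (w.2 < dorder x) = false, w.2 < dorder x + dorder y
       & w.2 - dorder x < dorder y]
  | [/\ (w.2 < dorder x) = false, (w.2 < dorder x + dorder y) = false
       & (w.2 - dorder x < dorder y) = false]].
  have [w1|w1] := ltnP w.2 (dorder x); first by apply: Or31; split=> //; lia.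
  have [w2|w2] := ltnP w.2 (dorder x + dorder y);
    by [apply: Or32; split=> //; lia | apply: Or33; split=> //; lia].
(* The last primed label of the product of [x] and [y] is the last one of [y]. *)
have last_lt : (dorder x + dorder y).-1 < dorder x + dorder y by lia.
have le_last : ((dorder x + dorder y).-1 < dorder x) = false by lia.
have last_y : unshift (dorder x) (true, (dorder x + dorder y).-1)
    = (true, (dorder y).-1) by congr pair => /=; lia.
have hu' : u.2 < dorder x + (dorder y + dorder z) by rewrite addnA.
have hv' : v.2 < dorder x + (dorder y + dorder z) by rewrite addnA.
have hsub (w : node) : (w.2 < dorder x) = false ->
    w.2 < dorder x + (dorder y + dorder z) ->
  w.2 - dorder x < dorder y + dorder z by lia.
case: (zone u) => [[u1 u2]|[u1 u2 u3]|[u1 u2 u3]];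
  case: (zone v) => [[v1 v2]|[v1 v2 v3]|[v1 v2 v3]];
  rewrite ?u1 ?u2 ?v1 ?v2 ?linked_mixed_op ?x0 ?y0 ?z0 ?orbT ?dorder_mixed_op ?hsub //=
    ?u1 ?u2 ?u3 ?v1 ?v2 ?v3 ?yp ?ltn_addr ?le_last ?last_y //.
all: rewrite ?u2 ?v2 // ?[linked y (true, 0) _]linked_sym -?andbA.
all: by case: (b); case: (c) => //=; rewrite ?andbF.
Qed.

(** * Restriction to consecutive labels and cancellation *)

Lemma dorder_of k (P : diagram k) : dorder P = k.
Proof. by []. Qed.

(** For [i + m <= dorder pi], the diagram induced on the labels i+1, ..., i+m, renumbered from 1.
    Its blocks are the fibres of the map sending a vertex to its block in [pi], so they form a
    partition automatically. *)
Definition restrict (pi : pdiagram) (i m : nat) : diagram m :=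
  Diagram (preim_partitionP
    (fun x : vertex m =>
       [set y : vertex (dorder pi) | linked pi (shift i (code x)) (code y)])
    [set: vertex m]).

Lemma linked_trans pi u v w : linked pi u v -> linked pi v w -> linked pi u w.
Proof.
case: pi => k P /existsP[x /existsP[y /and3P[/eqP<- /eqP<- xy]]].
case/existsP=> [y' /existsP[z /and3P[/eqP/code_inj-> /eqP<- yz]]].
rewrite (linked_code P); move: xy yz; rewrite -!pblock_eqE.
by move=> /eqP-> /eqP->.
Qed.

Lemma linked_restrict pi i m u v : i + m <= dorder pi -> u.2 < m -> v.2 < m ->
  linked (restrict pi i m) u v = linked pi (shift i u) (shift i v).
Proof.
move=> le_im /codeP[x ->] /codeP[y ->]; rewrite linked_code.
rewrite /restrict /= /preim_partition pblock_equivalence_partition ?inE //; last first.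
  by move=> a b c _ _ _; split=> // /eqP->.
apply/eqP/idP => [eqxy|xy].
  have /codeP[y' ey'] : (shift i (code y)).2 < dorder pi.
    by rewrite /=; have := code_lt y; lia.
  have : y' \in [set z : vertex (dorder pi) | linked pi (shift i (code y)) (code z)].
    by rewrite inE ey' linked_refl // code_lt.
  by rewrite -eqxy inE -ey'.
apply/setP=> z; rewrite !inE; apply/idP/idP; apply: linked_trans => //.
by rewrite linked_sym.
Qed.

Lemma restrict_left b pi rho : pi != empty_diagram -> rho != empty_diagram ->
  restrict (mixed_op b pi rho) 0 (dorder pi) = pi :> pdiagram.
Proof.
move=> pi0 rho0; apply: pdiagram_ext => // u v; rewrite dorder_of => hu hv.
rewrite linked_restrict ?dorder_mixed_op //; try lia.
have shift0 w : shift 0 w = w by case: w.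
by rewrite !shift0 linked_mixed_op ?pi0 ?rho0 ?orbT ?hu ?hv //; lia.
Qed.

Lemma restrict_right b pi rho : pi != empty_diagram -> rho != empty_diagram ->
  restrict (mixed_op b pi rho) (dorder pi) (dorder rho) = rho :> pdiagram.
Proof.
move=> pi0 rho0; apply: pdiagram_ext => // u v; rewrite dorder_of => hu hv.
rewrite linked_restrict ?dorder_mixed_op //; try lia.
rewrite linked_mixed_op ?pi0 ?rho0 ?orbT //=; try lia.
by rewrite !ltnNge !leq_addr /= !shiftK.
Qed.

(** A cut inside the left factor leaves a tail with the same last label, so the operation still acts
    at the same place. *)
Lemma restrict_mixed_op b pi rho i : i < dorder pi -> rho != empty_diagram ->
  restrict (mixed_op b pi rho) i (dorder pi + dorder rho - i)
    = mixed_op b (restrict pi i (dorder pi - i)) rho :> pdiagram.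
Proof.
move=> lti rho0; have pi0 : pi != empty_diagram by rewrite -dorder_gt0; lia.
set tau := pdiagram_of (restrict pi _ _).
have dtau : dorder tau = dorder pi - i by [].
have tau0 : tau != empty_diagram by rewrite -dorder_gt0 dtau; lia.
apply: pdiagram_ext => [|u v].
  by rewrite dorder_mixed_op dtau dorder_of; lia.
rewrite dorder_of => hu hv.
rewrite linked_restrict ?dorder_mixed_op //; try lia.
rewrite !linked_mixed_op ?pi0 ?rho0 ?tau0 ?dtau ?orbT //=; try lia.
have lt_sub w : (w < dorder pi - i) = (i + w < dorder pi) by lia.
have unsh w : unshift (dorder pi) (shift i w) = unshift (dorder pi - i) w.
  by congr pair => /=; lia.
rewrite !lt_sub !unsh /tau.
have lastE : shift i (true, (dorder pi - i).-1) = (true, (dorder pi).-1).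
  by congr pair => /=; lia.
by case: ltnP => hu1; case: ltnP => hv1; rewrite ?linked_restrict ?lastE //=; lia.
Qed.

(** Both factors are restrictions of the product, and the operation is [bullet] exactly when the two
    primed labels next to the cut are linked. *)
Lemma mixed_op_inj b c pi pi' rho rho' :
    pi != empty_diagram -> rho != empty_diagram ->
    pi' != empty_diagram -> rho' != empty_diagram ->
    dorder pi = dorder pi' ->
    mixed_op b pi rho = mixed_op c pi' rho' ->
  [/\ b = c, pi = pi' & rho = rho'].
Proof.
move=> pi0 rho0 pi'0 rho'0 eqd eqm.
have eqd' : dorder rho = dorder rho'.
  by have := congr1 dorder eqm; rewrite !dorder_mixed_op; lia.
have epi : pi = pi'.
  by rewrite -(restrict_left b pi0 rho0) -(restrict_left c pi'0 rho'0) eqm eqd.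
have erho : rho = rho'.
  by rewrite -(restrict_right b pi0 rho0) -(restrict_right c pi'0 rho'0) eqm eqd eqd'.
split=> //.
have := congr1 (fun p => linked p (true, (dorder pi).-1) (true, dorder pi)) eqm.
move: pi0 rho0; rewrite /= -epi -erho => pi0 rho0.
have := (pi0, rho0); rewrite -!dorder_gt0 => -[pip rhop].
rewrite !linked_mixed_op ?pi0 ?rho0 ?orbT //=; try lia.
rewrite prednK // leqnn ltnn linked_refl /=; last lia.
rewrite /unshift /= subnn linked_refl //.
by rewrite !andbT => /negb_inj.
Qed.

(* The analogue of Levi's lemma for words. *)
Lemma mixed_op_levi b c (pi pi' rho rho' : pdiagram) :
    rho != empty_diagram -> pi' != empty_diagram -> rho' != empty_diagram ->
    dorder pi' < dorder pi ->
    mixed_op b pi rho = mixed_op c pi' rho' ->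
  exists2 tau, tau != empty_diagram & rho' = mixed_op b tau rho.
Proof.
move=> rho0 pi'0 rho'0 ltd eqm.
exists (pdiagram_of (restrict pi (dorder pi') (dorder pi - dorder pi'))).
  by rewrite -dorder_gt0 dorder_of subn_gt0.
rewrite -restrict_mixed_op // eqm.
have -> : dorder pi + dorder rho - dorder pi' = dorder rho'.
  by have := congr1 dorder eqm; rewrite !dorder_mixed_op; lia.
by rewrite restrict_right.
Qed.

(** * Uniqueness of the refinement *)

Definition prime_diagram (p : pdiagram) : Prop :=
  [/\ p != empty_diagram, irreducible tensor p & irreducible bullet p].

Lemma prime_neq_mixed_op p b x y : prime_diagram p ->
  x != empty_diagram -> y != empty_diagram -> p <> mixed_op b x y.
Proof.
move=> [_ tp bp] x0 y0 e.
by case: b e => e; [apply: tp | apply: bp]; exists x, y.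
Qed.

(** Each operation is stored with the factor to its right, which spares the length condition of
    [refinement_of]. *)
Definition fold_mixed_op (p : pdiagram) (l : seq (bool * pdiagram)) : pdiagram :=
  foldl (fun acc x => mixed_op x.1 acc x.2) p l.

Lemma fold_mixed_op_rcons p l x :
  fold_mixed_op p (rcons l x) = mixed_op x.1 (fold_mixed_op p l) x.2.
Proof. exact: foldl_rcons. Qed.

Lemma fold_mixed_op_neq0 p l : p != empty_diagram -> fold_mixed_op p l != empty_diagram.
Proof. by elim: l p => //= x l IHl p p0; apply/IHl/mixed_op_neq0. Qed.

Definition all_prime (l : seq (bool * pdiagram)) : Prop :=
  forall x, x \in l -> prime_diagram x.2.

(** Induction from the right: if the last cuts were at different places, the analogue of Levi's
    lemma would write a prime last factor as a product. So they agree, and the last factor and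
    operation can be cancelled. *)
Lemma fold_mixed_op_inj p l p' l' :
    prime_diagram p -> all_prime l -> prime_diagram p' -> all_prime l' ->
    fold_mixed_op p l = fold_mixed_op p' l' ->
  p = p' /\ l = l'.
Proof.
move=> pp + pp'; elim/last_ind: l l' => [|l x IHl] l'; case/lastP: l' => [|l' x'] //.
- move=> _ pl'; rewrite fold_mixed_op_rcons => /prime_neq_mixed_op[] //.
    by apply: fold_mixed_op_neq0; case: pp'.
  by case: (pl' x') => //; rewrite mem_rcons mem_head.
- move=> pl _; rewrite fold_mixed_op_rcons => /esym/prime_neq_mixed_op[] //.
    by apply: fold_mixed_op_neq0; case: pp.
  by case: (pl x) => //; rewrite mem_rcons mem_head.
move=> pl pl'; rewrite !fold_mixed_op_rcons => eqm.
have px : prime_diagram x.2 by apply: pl; rewrite mem_rcons mem_head.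
have px' : prime_diagram x'.2 by apply: pl'; rewrite mem_rcons mem_head.
have x0 : x.2 != empty_diagram by case: px.
have x'0 : x'.2 != empty_diagram by case: px'.
have a0 : fold_mixed_op p l != empty_diagram by apply: fold_mixed_op_neq0; case: pp.
have a'0 : fold_mixed_op p' l' != empty_diagram by apply: fold_mixed_op_neq0; case: pp'.
have [lt|lt|eqd] := ltngtP (dorder (fold_mixed_op p l)) (dorder (fold_mixed_op p' l')).
- have [tau tau0 /prime_neq_mixed_op[]] // := mixed_op_levi x'0 a0 x0 lt (esym eqm).
- have [tau tau0 /prime_neq_mixed_op[]] // := mixed_op_levi x0 a'0 x'0 lt eqm.
have [ex ea ey] := mixed_op_inj a0 x0 a'0 x'0 eqd eqm.
have [||-> ->] := IHl l' _ _ ea.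
- by move=> y yl; apply: pl; rewrite mem_rcons in_cons yl orbT.
- by move=> y yl; apply: pl'; rewrite mem_rcons in_cons yl orbT.
by split=> //; congr rcons; case: (x) (x') ex ey => [? ?] [? ?] /= -> ->.
Qed.

(** Refinements concatenate, by mixed associativity; this serves both the existence of refinements
    and the count of tensors. *)
Lemma mixed_op_fold b p l p' l' :
    prime_diagram p -> prime_diagram p' -> all_prime l' ->
  mixed_op b (fold_mixed_op p l) (fold_mixed_op p' l')
    = fold_mixed_op p (l ++ (b, p') :: l').
Proof.
move=> [p0 _ _] [p'0 _ _]; elim/last_ind: l' => [|l' x IHl'] pl'.
  by rewrite cats1 fold_mixed_op_rcons.
have x0 : x.2 != empty_diagram.
  by case: (pl' x) => //; rewrite mem_rcons mem_head.
rewrite -rcons_cons -rcons_cat !fold_mixed_op_rcons -IHl' ?mixed_opA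
  ?fold_mixed_op_neq0 //.
by move=> y yl; apply: pl'; rewrite mem_rcons in_cons yl orbT.
Qed.

Lemma all_prime_cat l b p l' :
  all_prime l -> prime_diagram p -> all_prime l' -> all_prime (l ++ (b, p) :: l').
Proof.
move=> pl pp pl' x; rewrite mem_cat in_cons => /or3P[/pl|/eqP->|/pl'] //.
Qed.

(** Strong induction on the order: a diagram that is a product of non-empty ones has arguments of
    smaller order, and any other is prime. *)
Lemma fold_mixed_op_exists pi : pi != empty_diagram ->
  exists p l, [/\ prime_diagram p, all_prime l & pi = fold_mixed_op p l].
Proof.
have [n] := ubnP (dorder pi); elim: n pi => // n IHn pi; rewrite ltnS => le_n pi0.
have [[b [x [y [x0 y0 epi]]]]|irr] := boolp.EM (exists b x y,
    [/\ x != empty_diagram, y != empty_diagram & pi = mixed_op b x y]).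
  have := (x0, y0); rewrite -!dorder_gt0 => -[xp yp].
  have dpi : dorder pi = dorder x + dorder y by rewrite epi dorder_mixed_op.
  have [|//|p [l [pp pl ex]]] := IHn x; first by lia.
  have [|//|p' [l' [pp' pl' ey]]] := IHn y; first by lia.
  exists p, (l ++ (b, p') :: l'); split=> //; first exact: all_prime_cat.
  by rewrite epi ex ey mixed_op_fold.
exists pi, [::]; split=> //; split=> //.
  by case=> x [y [x0 y0 e]]; apply: irr; exists true, x, y.
by case=> x [y [x0 y0 e]]; apply: irr; exists false, x, y.
Qed.

Lemma refinement_of_fold p l : prime_diagram p -> all_prime l ->
  refinement_of (fold_mixed_op p l) (p :: unzip2 l, unzip1 l).
Proof.
move=> pp pl; split=> /=.
- by move=> q; rewrite in_cons => /orP[/eqP-> // | /mapP[x /pl px ->]].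
- by rewrite !size_map.
- by rewrite zip_unzip.
Qed.

Lemma refinement_of_empty : refinement_of empty_diagram ([::], [::]).
Proof. by []. Qed.

(** Passes from the pair of lists to the paired form, for which uniqueness was proved. *)
Lemma refinement_of_cases pi x : refinement_of pi x ->
  (pi = empty_diagram /\ x = ([::], [::])) \/
  exists p l, [/\ prime_diagram p, all_prime l, pi = fold_mixed_op p l
                & x = (p :: unzip2 l, unzip1 l)].
Proof.
case: x => [[|p s] ops] [/= ps sz ->]; first by left; case: ops sz.
right; exists p, (zip ops s); rewrite unzip1_zip ?unzip2_zip ?sz //.
split=> //; first by apply: ps; rewrite mem_head.
move=> x /(map_f snd); rewrite -/(unzip2 _) unzip2_zip ?sz // => xs.
by apply: ps; rewrite in_cons xs orbT.
Qed.

Lemma refinement_of_inj pi x y : refinement_of pi x -> refinement_of pi y -> x = y.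
Proof.
move=> /refinement_of_cases[[-> ->]|[p [l [pp pl -> ->]]]]
  /refinement_of_cases[[e ->]|[p' [l' [pp' pl' e ->]]]] //.
- by have := fold_mixed_op_neq0 l' (let: And3 h _ _ := pp' in h); rewrite -e eqxx.
- by have := fold_mixed_op_neq0 l (let: And3 h _ _ := pp in h); rewrite e eqxx.
by have [-> ->] := fold_mixed_op_inj pp pl pp' pl' e.
Qed.

Lemma refinementP pi : refinement_of pi (refinement pi).
Proof.
apply: classical_sets.xgetPex; have [->|pi0] := eqVneq pi empty_diagram.
  by exists ([::], [::]).
have [p [l [pp pl ->]]] := fold_mixed_op_exists pi0.
by exists (p :: unzip2 l, unzip1 l); apply: refinement_of_fold.
Qed.

Lemma refinement_eq pi x : refinement_of pi x -> refinement pi = x.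
Proof. exact/refinement_of_inj/refinementP. Qed.

(** The order depends on the factors alone, so similar diagrams have equal orders and sums over
    [diagram (dorder pi)] miss none of them. *)
Lemma dorder_refined_product s ops : size ops = (size s).-1 ->
  dorder (refined_product s ops) = sumn (map dorder s).
Proof.
case: s => //= p s; elim: s ops p => [|q s IHs] [|b ops] p //=; first by rewrite addn0.
by case=> sz; rewrite IHs // -/(mixed_op b) dorder_mixed_op addnA.
Qed.

(** * The number of tensor factors *)

Lemma tensor0p : left_id empty_diagram tensor.
Proof.
move=> pi; apply: pdiagram_ext => // u v hu hv.
by rewrite (@linked_mixed_op true) // /unshift !subn0; case: u v {hu hv} => ? ? [].
Qed.

Lemma tensorp0 : right_id empty_diagram tensor.
Proof.
move=> pi; have d : dorder (tensor pi empty_diagram) = dorder pi by exact: addn0.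
apply: pdiagram_ext => // u v; rewrite d => hu hv.
by rewrite (@linked_mixed_op true) ?addn0 // hu hv.
Qed.

Lemma tensorA : associative tensor.
Proof.
move=> x y z.
have [->|x0] := eqVneq x empty_diagram; first by rewrite !tensor0p.
have [->|y0] := eqVneq y empty_diagram; first by rewrite tensor0p tensorp0.
have [->|z0] := eqVneq z empty_diagram; first by rewrite !tensorp0.
exact: esym (mixed_opA true true x0 y0 z0).
Qed.

HB.instance Definition _ :=
  Monoid.isLaw.Build pdiagram empty_diagram tensor tensorA tensor0p tensorp0.

Lemma tensor_factorization_exists pi : exists s, tensor_factorization pi s.
Proof.
have [n] := ubnP (dorder pi); elim: n pi => // n IHn pi; rewrite ltnS => le_n.
have [->|pi0] := eqVneq pi empty_diagram.
  by exists [::]; rewrite /tensor_factorization big_nil.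
have [[x [y [x0 y0 epi]]]|irr] := boolp.EM (exists x y,
    [/\ x != empty_diagram, y != empty_diagram & pi = tensor x y]).
  have := (x0, y0); rewrite -!dorder_gt0 => -[xp yp].
  have dpi : dorder pi = dorder x + dorder y by rewrite epi (dorder_mixed_op true).
  have [|s [ps ex]] := IHn x; first by lia.
  have [|s' [ps' ey]] := IHn y; first by lia.
  exists (s ++ s'); split; last by rewrite big_cat /= -ex -ey.
  by move=> p; rewrite mem_cat => /orP[/ps|/ps'].
by exists [:: pi]; split=> [p|]; rewrite ?big_seq1 // inE => /eqP->.
Qed.

(** A [tensor] in the refinement would split the diagram at that place. *)
Lemma tensor_irreducible_fold p l : prime_diagram p -> all_prime l ->
  irreducible tensor (fold_mixed_op p l) -> count id (unzip1 l) = 0.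
Proof.
move=> pp pl irr; apply/eqP; rewrite -leqn0 leqNgt -has_count; apply/negP.
case/hasP=> b /mapP[[c q] /[swap] -> /= xl cT]; rewrite cT {c cT} in xl *.
case/splitPr: xl pl irr => l1 l2 pl [].
have pq : prime_diagram q by apply: (pl (true, q)); rewrite mem_cat mem_head orbT.
have pl2 : all_prime l2.
  by move=> x xl; apply: pl; rewrite mem_cat in_cons xl !orbT.
exists (fold_mixed_op p l1), (fold_mixed_op q l2); rewrite -(@mixed_op_fold true) //.
by split=> //; apply: fold_mixed_op_neq0; [case: pp | case: pq].
Qed.

(** The refinements of the tensor factors contain only bullets, and joining the factors adds one
    [tensor] at each junction. *)
Lemma tensor_product_fold q s :
    (forall p, p \in q :: s -> p != empty_diagram /\ irreducible tensor p) ->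
  exists p l, [/\ prime_diagram p, all_prime l,
    \big[tensor/empty_diagram]_(x <- q :: s) x = fold_mixed_op p l
    & count id (unzip1 l) = size s].
Proof.
elim: s q => [|q' s IHs] q irr; have [q0 qirr] := irr q (mem_head _ _);
  have [p [l [pp pl eq]]] := fold_mixed_op_exists q0;
  have cl : count id (unzip1 l) = 0
    by [apply: (tensor_irreducible_fold pp); rewrite -?eq].
  by exists p, l; rewrite big_seq1.
have [|p' [l' [pp' pl' eq' cl']]] := IHs q'.
  by move=> x xs; apply: irr; rewrite in_cons xs orbT.
exists p, (l ++ (true, p') :: l'); split=> //; first exact: all_prime_cat.
  rewrite big_cons eq' eq; exact: (mixed_op_fold true _ pp pp' pl').
by rewrite /unzip1 map_cat count_cat -!/(unzip1 _) cl /= cl'.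
Qed.

(** This is |S| + 1 for non-empty [pi], and the boolean makes it 0 for the empty diagram. The count
    is the same for whichever tensor factorization was chosen. *)
Lemma ellE pi : ell pi = count id (operations pi) + (0 < size (factors pi)).
Proof.
have : tensor_factorization pi (tensor_factors pi).
  by apply: classical_sets.xgetPex; exact: tensor_factorization_exists.
rewrite /ell /operations /factors; case: (tensor_factors pi) => [|q s] [irr ->].
  by rewrite big_nil (refinement_eq refinement_of_empty).
have [p [l [pp pl -> cl]]] := tensor_product_fold irr.
by rewrite (refinement_eq (refinement_of_fold pp pl)) /= cl addn1.
Qed.

Local Open Scope ring_scope.

(** * Similar diagrams as subsets *)

(** When [N] is the number of operations, this is [Sset] numbered from 0; as a set over a finite
    type it can index big operators. [fset_of] restores the numbering from 1. *)
Definition opset N (pi : pdiagram) : {set 'I_N} :=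
  [set i : 'I_N | nth false (operations pi) i].

Definition fset_of N (A : {set 'I_N}) : {fset nat} := [fset i.+1 | i : 'I_N in A]%fset.

Lemma size_operations pi : size (operations pi) = (size (factors pi)).-1.
Proof. by case: (refinementP pi). Qed.

Lemma mem_fset_of N (A : {set 'I_N}) (i : 'I_N) : (i.+1 \in fset_of A) = (i \in A).
Proof.
apply/imfsetP/idP => [[j /= jA [] /val_inj->] //|iA]; by exists i.
Qed.

Lemma fset_ofP N (A : {set 'I_N}) i :
  reflect (exists2 j : 'I_N, j \in A & i = j.+1) (i \in fset_of A).
Proof. by apply: (iffP (imfsetP _ _ _ _)) => -[j jA ->]; exists j. Qed.

Lemma fset_of_gen N (X : {fset nat}) (A : {set 'I_N}) :
    (forall i, i \in X -> 0 < i <= N)%N ->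
    (forall i : 'I_N, (i.+1 \in X) = (i \in A)) ->
  X = fset_of A.
Proof.
move=> sX eX; apply/fsetP=> i; apply/idP/fset_ofP => [iX|[j jA ->]].
  have := sX i iX; case: i iX => // i iX /= ltiN.
  by exists (Ordinal ltiN); rewrite // -eX.
by rewrite eX.
Qed.

Lemma fset_of_range N (A : {set 'I_N}) i : i \in fset_of A -> (0 < i <= N)%N.
Proof. by case/fset_ofP=> j _ ->; apply: ltn_ord. Qed.

Lemma card_fset_of N (A : {set 'I_N}) : #|` fset_of A| = #|A|.
Proof.
rewrite card_imfset /=; last by move=> i j [] /val_inj.
by rewrite cardE !size_filter.
Qed.

Lemma fset_ofD N (A B : {set 'I_N}) :
  (fset_of A `\` fset_of B)%fset = fset_of (A :\: B).
Proof.
apply: fset_of_gen => [i|i]; first by case/fsetDP=> /fset_of_range.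
by rewrite in_fsetD !mem_fset_of in_setD.
Qed.

Lemma fset_ofI N (A B : {set 'I_N}) :
  (fset_of A `&` fset_of B)%fset = fset_of (A :&: B).
Proof.
apply: fset_of_gen => [i|i]; first by case/fsetIP=> /fset_of_range.
by rewrite in_fsetI !mem_fset_of in_setI.
Qed.

Lemma fset_ofU N (A B : {set 'I_N}) :
  (fset_of A `|` fset_of B)%fset = fset_of (A :|: B).
Proof.
apply: fset_of_gen => [i|i]; first by case/fsetUP=> /fset_of_range.
by rewrite in_fsetU !mem_fset_of in_setU.
Qed.

Lemma fset_ofS N (A B : {set 'I_N}) : (fset_of A `<=` fset_of B)%fset = (A \subset B).
Proof.
apply/fsubsetP/subsetP => [sAB i|sAB _ /fset_ofP[i iA ->]].
  by rewrite -!mem_fset_of; apply: sAB.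
by rewrite mem_fset_of sAB.
Qed.

Lemma mem_upto N i : (i \in upto N) = (0 < i <= N)%N.
Proof. by rewrite !inE /= mem_iota add1n ltnS. Qed.

Lemma upto_fset_of N : upto N = fset_of [set: 'I_N].
Proof.
apply: fset_of_gen => [i|i]; first by rewrite mem_upto.
by rewrite mem_upto inE /= ltn_ord.
Qed.

Lemma mem_Sset pi i : (i \in Sset pi) =
  (0 < i <= (size (factors pi)).-1)%N && nth false (operations pi) i.-1.
Proof. by rewrite -mem_upto in_fset !inE. Qed.

Lemma Sset_fset_of N pi : (size (factors pi)).-1 = N -> Sset pi = fset_of (opset N pi).
Proof.
move=> <-; apply: fset_of_gen => i; first by rewrite mem_Sset => /andP[].
by rewrite mem_Sset inE ltn_ord.
Qed.

Lemma card_opset N pi : (size (factors pi)).-1 = N ->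
  #|opset N pi| = count id (operations pi).
Proof.
move=> eN; rewrite -sum1_count (big_nth false) big_mkord size_operations eN.
by rewrite sum1dep_card.
Qed.

Lemma factors_neq0 pi : (0 < size (factors pi))%N = (pi != empty_diagram).
Proof.
case: (refinement_of_cases (refinementP pi)); rewrite /factors.
  by case=> -> ->; rewrite eqxx.
by case=> p [l [[p0 _ _] _ -> ->]]; rewrite fold_mixed_op_neq0.
Qed.

Lemma dorderP pi k : dorder pi = k -> exists P : diagram k, pi = P.
Proof. by case: pi => m P ekm; case: k / ekm; exists P. Qed.

(** Uniqueness of the refinement makes [opset] a bijection from the similarity class onto all
    subsets. *)
Lemma sum_sim (V : nmodType) (pi : pdiagram) N (F : {set 'I_N} -> V) :
    (size (factors pi)).-1 = N ->
  \sum_(rho : diagram (dorder pi) | sim rho pi) F (opset N rho) = \sum_A F A.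
Proof.
move=> eN; pose X := [set rho : diagram (dorder pi) | sim rho pi].
have -> : \sum_(rho : diagram (dorder pi) | sim rho pi) F (opset N rho)
    = \sum_(rho in X) F (opset N rho) by apply: eq_bigl => rho; rewrite inE.
rewrite -(big_imset F) /=; last first.
  (* Injectivity: equal factors and equal operations give equal refined products. *)
  move=> rho sigma; rewrite !inE => /eqP frho /eqP fsigma eo.
  have eops : operations rho = operations sigma.
    apply: (@eq_from_nth _ false);
      rewrite !size_operations frho ?fsigma // eN => i ltiN.
    by have /setP/(_ (Ordinal ltiN)) := eo; rewrite !inE.
  have [_ _ erho] := refinementP rho; have [_ _ esigma] := refinementP sigma.
  have := erho; rewrite -/(factors rho) -/(operations rho) frho -fsigma eops -esigma.
  by move/eqP; rewrite /pdiagram_of eq_Tagged /= => /eqP.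
apply: eq_bigl => A; apply/imsetP.
(* Surjectivity: keep the factors of [pi] and put [tensor] exactly at the positions in [A]. *)
pose ops := [seq i \in [seq val j | j in A] | i <- iota 0 N].
have sz : size ops = (size (factors pi)).-1 by rewrite size_map size_iota.
have [pp spi epi] := refinementP pi.
have ref : refinement_of (refined_product (factors pi) ops) (factors pi, ops) by [].
have ord : dorder (refined_product (factors pi) ops) = dorder pi.
  by rewrite dorder_refined_product // {2}epi dorder_refined_product.
have [d ed] := dorderP ord; rewrite ed in ref.
have refd := refinement_eq ref.
exists d; first by rewrite inE /sim /factors refd.
apply/setP=> i; rewrite inE /operations refd /= (nth_map 0%N) ?size_iota //.
rewrite nth_iota // add0n; apply/idP/mapP => [iA|[j + /val_inj->]].
  by exists i; rewrite ?mem_enum.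
by rewrite mem_enum.
Qed.

(** * Signed sums over subsets *)

Section SubsetSums.

Variables (K : comNzRingType) (N : nat).
Implicit Types A B C : {set 'I_N}.

Lemma prod_const_if A (x : K) :
  \prod_i (if i \in A then x else 1) = x ^+ #|A|.
Proof. by rewrite -big_mkcond prodr_const. Qed.

(** The summand is a product over the elements of [A], with factor q inside [B] and -1 outside. The
    sum is thus a product over [C] of factors q + 1 or -1 + 1 = 0. *)
Lemma sum_subset (q : K) B C :
  \sum_(A : {set 'I_N} | A \subset C) (-1) ^+ #|A :\: B| * q ^+ #|A :&: B|
    = if C \subset B then (q + 1) ^+ #|C| else 0.
Proof.
pose f i := if i \in C then (if i \in B then q else -1) else 0.
(* [f] vanishes outside [C], so the expansion discards the sets not contained in [C]. *)
transitivity (\prod_i (f i + 1)).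
  rewrite bigA_distr big_mkcond; apply: eq_bigr => A _.
  case: ifP => [sAC|/negbT/subsetPn[i iA iC]]; last first.
    by rewrite (bigD1 i) //= iA /f (negPf iC) mul0r.
  rewrite -!prod_const_if -big_split; apply: eq_bigr => i _; rewrite !inE /f.
  case: (boolP (i \in A)) => iA /=; rewrite ?andbF /= ?mulr1 //.
  by rewrite (subsetP sAC i iA) andbT; case: (i \in B); rewrite ?mul1r ?mulr1.
have [sCB|/subsetPn[i iC iB]] := boolP (C \subset B); last first.
  by rewrite (bigD1 i) //= /f iC (negPf iB) addNr mul0r.
rewrite -prod_const_if; apply: eq_bigr => i _; rewrite /f.
case: ifP => [/(subsetP sCB)->//|_]; by rewrite add0r.
Qed.

(** Complementing [A] gives the previous sum for the complements of [B] and [C]. *)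
Lemma sum_superset (q : K) B C :
  \sum_(A : {set 'I_N} | C \subset A) (-1) ^+ #|B :\: A| * q ^+ #|~: (A :|: B)|
    = if B \subset C then (q + 1) ^+ #|~: C| else 0.
Proof.
rewrite -setCS -sum_subset [LHS](reindex_inj (@setC_inj _)).
apply: eq_big => [A|A _]; first by rewrite -setCS setCK.
by rewrite setCU !setDE !setCK (setIC B).
Qed.

End SubsetSums.

(** In use, [e] is the 0 or 1 by which l exceeds |S|; it cancels, and by parity the difference may
    be replaced by a sum of naturals. *)
Lemma signz_subDr (K : fieldType) (m n e : nat) :
  (-1 : K) ^ ((m + e)%N%:Z - (n + e)%N%:Z) = (-1) ^+ (m + n).
Proof.
rewrite !PoszD opprD addrACA subrr addr0 expfzDr ?oppr_eq0 ?oner_eq0 //.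
by rewrite -invr_expz -exprVn invrN1 -exprD.
Qed.

(** In use, [m] is the size of the summation set; it occurs twice and drops out by parity. *)
Lemma sign_cancel (K : comNzRingType) (a m n p : nat) :
  (-1 : K) ^+ (a + m + n) * (-1) ^+ (p + m) = (-1) ^+ (p + n) * (-1) ^+ a.
Proof.
rewrite -!exprD -[LHS]signr_odd -[RHS]signr_odd !oddD.
by case: (odd a); case: (odd m); case: (odd n); case: (odd p).
Qed.

(** * Coefficients within a similarity class *)

Section SimilarDiagrams.

Variables (K : fieldType) (pi0 : pdiagram) (N : nat).
Hypothesis sizeN : (size (factors pi0)).-1 = N.

Lemma size_sim (rho : pdiagram) : sim rho pi0 -> (size (factors rho)).-1 = N.
Proof. by move=> /eqP->. Qed.

Lemma ell_sim (rho : pdiagram) : sim rho pi0 ->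
  ell rho = (#|opset N rho| + (pi0 != empty_diagram))%N.
Proof.
move=> s; rewrite ellE (card_opset (size_sim s)) -factors_neq0.
by move/eqP: s => ->.
Qed.

Lemma ple_sim (rho sigma : pdiagram) : sim sigma pi0 ->
  ple rho sigma = sim rho sigma && (opset N sigma \subset opset N rho).
Proof.
move=> s; rewrite /ple; case: (boolP (sim rho sigma)) => //= /eqP e.
rewrite (Sset_fset_of (size_sim s)) (@Sset_fset_of N) ?fset_ofS //.
by rewrite e size_sim.
Qed.

Lemma sim_trans_eq (rho sigma : pdiagram) : sim sigma pi0 ->
  sim rho sigma = sim rho pi0.
Proof. by move=> /eqP e; rewrite /sim e. Qed.

Lemma kappaE (r : K) (pi : pdiagram) : sim pi pi0 ->
  kappa r pi = \sum_(sigma : diagram (dorder pi) |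
      sim sigma pi0 && (opset N pi \subset opset N sigma))
    ((-1) ^+ (#|opset N sigma| + #|opset N pi|)
     * r ^- (#|opset N sigma| + (pi0 != empty_diagram))) *: Hbasis K sigma.
Proof.
move=> s; apply: eq_big => [sigma|sigma]; rewrite ple_sim // sim_trans_eq //.
by case/andP=> s' _; rewrite !ell_sim // signz_subDr.
Qed.

Lemma ribbonE (pi : pdiagram) : sim pi pi0 ->
  ribbon K pi = \sum_(sigma : diagram (dorder pi) |
      sim sigma pi0 && (opset N sigma \subset opset N pi))
    (-1) ^+ (#|opset N sigma| + #|opset N pi|) *: Hbasis K sigma.
Proof.
move=> s.
have pleE (sigma : diagram (dorder pi)) :
    ple pi sigma = sim sigma pi0 && (opset N sigma \subset opset N pi).
  have simC : sim pi sigma = sim sigma pi0.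
    by rewrite /sim eq_sym (eqP s).
  by rewrite /ple simC; case: (boolP (sim sigma pi0)) => // s';
    rewrite !(@Sset_fset_of N) ?fset_ofS ?size_sim.
apply: eq_big => [sigma|sigma]; first exact: pleE.
by rewrite pleE => /andP[s' _]; rewrite !ell_sim // signz_subDr.
Qed.

(** Serves both formulas, with [le] inclusion or its converse. After the exchange, the inner sum
    over similar diagrams depends only on their [opset], so [sum_sim] applies. *)
Lemma sum_sim_exchange (V : lmodType K) (X : diagram (dorder pi0) -> V)
    (c : {set 'I_N} -> K) (d : {set 'I_N} -> {set 'I_N} -> K)
    (le : rel {set 'I_N}) :
  \sum_(rho : diagram (dorder pi0) | sim rho pi0) c (opset N rho) *:
    (\sum_(sigma : diagram (dorder pi0) |
       sim sigma pi0 && le (opset N rho) (opset N sigma))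
       d (opset N rho) (opset N sigma) *: X sigma)
  = \sum_(sigma : diagram (dorder pi0) | sim sigma pi0)
      (\sum_(A | le A (opset N sigma)) c A * d A (opset N sigma)) *: X sigma.
Proof.
under eq_bigr do rewrite scaler_sumr.
rewrite (exchange_big_dep (fun sigma : diagram (dorder pi0) => sim sigma pi0)) /=;
  last by move=> ? ? _ /andP[].
apply: eq_bigr => sigma s; rewrite [in RHS]big_mkcond.
rewrite -(sum_sim (fun A => if le A (opset N sigma) then _ else 0) sizeN).
rewrite scaler_suml big_mkcondr s /=; apply: eq_bigr => rho _.
by case: ifP => _; rewrite ?scale0r // scalerA.
Qed.

End SimilarDiagrams.

(** * The two change-of-basis formulas *)

Theorem proposition9p6 (K : fieldType) (r : K) (hr : r \is a GRing.unit) :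
  let q : K := r - 1 in
  (forall pi : pdiagram, pi != empty_diagram ->
     ribbon K pi =
     r *: \sum_(rho : diagram (dorder pi) | sim rho pi)
       ((-1) ^ (#|` (Sset rho `\` Sset pi)%fset|%:Z + (ell rho)%:Z - (ell pi)%:Z)
        * q ^+ #|` (Sset rho `&` Sset pi)%fset|) *: kappa r rho)
  /\
  (forall (n : nat) (pi : pdiagram), pi \in Iset n ->
     kappa r pi =
     r ^- n *: \sum_(rho : diagram (dorder pi) | sim rho pi)
       ((-1) ^ (#|` (Sset pi `\` Sset rho)%fset|%:Z + (ell rho)%:Z - (ell pi)%:Z)
        * q ^+ #|` (upto n.-1 `\` (Sset rho `|` Sset pi))%fset|) *: ribbon K rho).
Proof.
move=> q; have q1 : q + 1 = r by rewrite subrK.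
have r0 : r != 0 by rewrite -unitfE.
have simxx pi : sim pi pi by apply: eqxx.
split=> [pi pi0|n pi /eqP en]; set N := (size (factors pi)).-1; set B := opset N pi;
  have eN : (size (factors pi)).-1 = N by [].
(* [c] is the coefficient of the kappa with S(rho) = A, and [d] that of H with S(sigma) = C in it.
   The exponent in [d] is l(sigma) = |C| + 1, as [pi] is non-empty. *)
- pose c (A : {set 'I_N}) := (-1) ^+ (#|A :\: B| + #|A| + #|B|) * q ^+ #|A :&: B|.
  pose d (A C : {set 'I_N}) := (-1) ^+ (#|C| + #|A|) * r ^- (#|C| + 1) : K.
  transitivity (r *: \sum_(rho : diagram (dorder pi) | sim rho pi) c (opset N rho) *:
    (\sum_(sigma : diagram (dorder pi) |
       sim sigma pi && (opset N rho \subset opset N sigma))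
       d (opset N rho) (opset N sigma) *: Hbasis K sigma)); last first.
    congr (_ *: _); apply: eq_bigr => rho s; rewrite (kappaE eN r s) pi0.
    congr (_ *: _); rewrite !(@Sset_fset_of N) ?(size_sim eN s) // fset_ofD
      fset_ofI !card_fset_of.
    by rewrite !(ell_sim eN) // -PoszD addnA signz_subDr.
  rewrite (sum_sim_exchange eN _ c d (fun A C => A \subset C)).
  rewrite (ribbonE K eN (simxx pi)) scaler_sumr big_mkcondr; apply: eq_bigr => sigma _.
  rewrite scalerA; set C := opset N sigma.
  have -> : \sum_(A : {set 'I_N} | A \subset C) c A * d A C =
      (-1) ^+ (#|C| + #|B|) * r ^- (#|C| + 1)
      * \sum_(A : {set 'I_N} | A \subset C) (-1) ^+ #|A :\: B| * q ^+ #|A :&: B|.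
    rewrite mulr_sumr; apply: eq_bigr => A _; rewrite /c /d mulrACA sign_cancel.
    by rewrite (mulrC (q ^+ _)) mulrACA.
  (* Only [C] inside [B] survives, with value r^|C|, which together with the outer factor r cancels
     r^-(|C|+1). *)
  rewrite sum_subset q1; case: ifP => _; last by rewrite !mulr0 scale0r.
  by rewrite mulrCA -mulrA -exprS addn1 mulVf ?expf_neq0 // mulr1.
(* The same scheme with ribbons inside and a sum over the supersets of [C]. *)
pose c (A : {set 'I_N}) := (-1) ^+ (#|B :\: A| + #|A| + #|B|) * q ^+ #|~: (A :|: B)|.
pose d (A C : {set 'I_N}) := (-1) ^+ (#|C| + #|A|) : K.
transitivity (r ^- n *: \sum_(rho : diagram (dorder pi) | sim rho pi) c (opset N rho) *:
    (\sum_(sigma : diagram (dorder pi) |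
       sim sigma pi && (opset N sigma \subset opset N rho))
       d (opset N rho) (opset N sigma) *: Hbasis K sigma)); last first.
  congr (_ *: _); apply: eq_bigr => rho s; rewrite (ribbonE K eN s).
  congr (_ *: _); rewrite !(@Sset_fset_of N) ?(size_sim eN s) // -en upto_fset_of.
  rewrite fset_ofU !fset_ofD setTD !card_fset_of.
  by rewrite !(ell_sim eN) // -PoszD addnA signz_subDr.
rewrite (sum_sim_exchange eN _ c d (fun A C => C \subset A)).
rewrite (kappaE eN r (simxx pi)) scaler_sumr big_mkcondr; apply: eq_bigr => sigma _.
rewrite scalerA; set C := opset N sigma.
have -> : \sum_(A : {set 'I_N} | C \subset A) c A * d A C =
    (-1) ^+ (#|C| + #|B|) * \sum_(A : {set 'I_N} | C \subset A)
      (-1) ^+ #|B :\: A| * q ^+ #|~: (A :|: B)|.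
  rewrite mulr_sumr; apply: eq_bigr => A _.
  by rewrite /c /d mulrAC sign_cancel mulrA.
rewrite sum_superset q1; case: ifP => _; last by rewrite !mulr0 scale0r.
(* [n] is |C| plus the size of its complement, plus 1 unless [pi] is empty; hence r^-n times the
   power of r from the sum is r^-l(sigma). *)
have -> : n = (#|C| + (pi != empty_diagram) + #|~: C|)%N.
  rewrite addnAC cardsC card_ord -factors_neq0 -en /N.
  by case: (size _) => // m; rewrite addn1.
by rewrite mulrCA (exprD r _ #|~: C|) invfM -[_ * r ^+ _]mulrA mulVf ?mulr1 ?expf_neq0.
Qed.
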